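(* Let $\mathbb F$ be an algebraically closed field, and let $\mathbb A$ and $\mathbb A'$ be two isomorphic finite-dimensional non-degenerate evolution algebras over $\mathbb F$. Then $\Delta(\mathbb A)=\Delta(\mathbb A')$, where $\Delta$ denotes the $\Delta$-trace.
   Context: Algebras are finite-dimensional over $\mathbb F$ with a bilinear product, not necessarily associative. An evolution algebra is an algebra having a basis $\{e_1,\dots,e_n\}$ (a natural basis) with $e_ie_j=0$ for $i\ne j$. It is non-degenerate if $\mathrm{Ann}(\mathbb A)=\{x: x\mathbb A+\mathbb Ax=0\}$ is zero. An extending evolution subspace is a linear subspace spanned by a subset of some natural basis of $\mathbb A$. For subspaces $X,Y$, $XY$ denotes the linear span of all products $xy$, and $X^2=XX$. Every non-degenerate evolution algebra has a unique (up to order) decomposition $\mathbb A=\mathbb E_1\oplus\dots\oplus\mathbb E_r$ (the standard extending evolution subspaces decomposition), where the $\mathbb E_i$ are extending evolution subspaces with $\dim(\mathbb E_i^2)=1$, and $\mathbb E_i\mathbb E_j=0$, $\dim(\mathbb E_i^2+\mathbb E_j^2)=2$ for $i\neq j$. For each $i$, let $\pi_{\mathbb E_i}:\mathbb A\to\mathbb E_i$ be the projection along the other summands, and let $\mathbb A_i$ be the algebra on the vector space $\mathbb E_i$ with product $x\cdot_{\mathbb A_i}y=\pi_{\mathbb E_i}(xy)$. It is either an algebra with zero product or a non-degenerate evolution algebra with $\dim(\mathbb A_i^2)=1$. Consider the following algebras with basis $e_1,\dots,e_m$ (and $e_ie_j=0$ for $i\ne j$): $\mathbf O_m$ (zero product);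 $\mathbf E_m$: $e_1^2=\dots=e_m^2=e_1$; and, for $m\ge2$, $\mathbf I_m$: $e_1^2=\dots=e_m^2=e_1+\mathbf i e_2$, where $\mathbf i\in\mathbb F$ is a fixed element with $\mathbf i^2=-1$. With $m=\dim\mathbb E_i$, put $\overline{\mathbb A_i}=\mathbf O_m$ if $\mathbb A_i\cong\mathbf O_m$, $\overline{\mathbb A_i}=\mathbf E_m$ if $\mathbb A_i\cong\mathbf E_m$, and $\overline{\mathbb A_i}=\mathbf I_m$ if $\mathbb A_i\cong\mathbf I_m$. The $\Delta$-trace of $\mathbb A$ is the sequence $\Delta(\mathbb A)=(\overline{\mathbb A_1},\dots,\overline{\mathbb A_r})$, where the $\mathbb A_i$ are ordered by non-increasing dimension and, in equal dimension $m$, with copies of $\mathbf O_m$ first, then $\mathbf E_m$, then $\mathbf I_m$. *)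

(* Defs.v *)
From mathcomp Require Import all_boot all_order all_algebra.
From mathcomp Require Import boolp.

Set Implicit Arguments.
Unset Strict Implicit.
Unset Printing Implicit Defensive.

Import GRing.Theory.
Local Open Scope ring_scope.

(* A (not necessarily associative) finite-dimensional algebra is a
   [vectType F] together with its product, a bilinear map. *)

Definition alg_iso (F : fieldType) (U V : vectType F)
    (mulU : U -> U -> U) (mulV : V -> V -> V) : Prop :=
  exists f : {linear U -> V},
    bijective f /\ forall x y, f (mulU x y) = mulV (f x) (f y).

Section EvolutionAlgebras.
Variables (F : fieldType) (A : vectType F) (mulA : {bilinear A -> A -> A}).
Implicit Types (e s : seq A) (X Y W : {vspace A}).

Definition nondegenerate_algebra : Prop :=
  forall x : A, (forall y, mulA x y = 0 /\ mulA y x = 0) -> x = 0.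

(* The members of a basis are pairwise distinct, so quantifying over distinct
   members is the same as quantifying over distinct indices. *)
Definition natural_basis e : Prop :=
  basis_of fullv e /\ {in e &, forall x y, x != y -> mulA x y = 0}.

Definition evolution_algebra : Prop := exists e, natural_basis e.

Definition ext_evol_subspace X : Prop :=
  exists e s, [/\ natural_basis e, {subset s <= e} & X = <<s>>%VS].

(* Same definition as [prodv] of falgebra, which requires an associative
   product; [prodspP] shows that it is the span of all products. *)
Definition prodsp X Y : {vspace A} :=
  <<[seq mulA x y | x <- vbasis X, y <- vbasis Y]>>%VS.

Definition std_decomposition r (E : 'I_r -> {vspace A}) : Prop :=
  [/\ (\sum_i E i = fullv)%VS /\ directv (\sum_i E i),
      forall i, ext_evol_subspace (E i),
      forall i, \dim (prodsp (E i) (E i)) = 1%N &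
      forall i j, i != j ->
        prodsp (E i) (E j) = 0%VS
        /\ \dim (prodsp (E i) (E i) + prodsp (E j) (E j)) = 2].

(* [sumv_pi (\sum_j E j) i] is the projection onto [E i] along the other
   summands when the sum is direct and equal to the whole space. *)
Definition component_mul r (E : 'I_r -> {vspace A}) (i : 'I_r)
    (x y : subvs_of (E i)) : subvs_of (E i) :=
  vsproj (E i) (sumv_pi (\sum_j E j)%VS i (mulA (vsval x) (vsval y))).

Lemma mem_prodsp X Y x y : x \in X -> y \in Y -> mulA x y \in prodsp X Y.
Proof.
move=> /coord_vbasis-> /coord_vbasis->.
rewrite linear_sumlz memv_suml // => i _.
rewrite linear_sumr memv_suml // => j _.
rewrite linearZl_LR linearZr_LR !memvZ // memv_span //.
by apply/allpairsP; exists ((vbasis X)`_i, (vbasis Y)`_j); rewrite !memt_nth.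
Qed.

Lemma prodspP X Y W :
  reflect {in X & Y, forall x y, mulA x y \in W} (prodsp X Y <= W)%VS.
Proof.
apply: (iffP idP) => [/subvP sW x y Xx Yy | sW]; first exact/sW/mem_prodsp.
apply/span_subvP=> _ /allpairsP[[x y] /= [Xx Yy ->]].
by rewrite sW ?vbasis_mem.
Qed.

Lemma natural_basis_sqr_neq0 e x :
  nondegenerate_algebra -> natural_basis e -> x \in e -> mulA x x != 0.
Proof.
move=> nd [be orth] ex; apply/eqP => xx0.
have fe := basis_free be.
suff x0 : x = 0 by move/free_not0: fe => /(_ _ ex); rewrite x0 eqxx.
apply: nd => y.
have h z : z \in e -> mulA x z = 0 /\ mulA z x = 0.
  by move=> ez; have [<-//|xz] := eqVneq x z; rewrite !orth // eq_sym.
have : y \in <<e>>%VS by rewrite (span_basis be) memvf.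
move/(@coord_span _ _ _ (in_tuple e)) => ->.
rewrite linear_sumlz linear_sumr; split; apply: big1 => i _.
  by rewrite linearZr_LR (h e`_i _).1 ?scaler0 ?mem_nth.
by rewrite linearZl_LR (h e`_i _).2 ?scaler0 ?mem_nth.
Qed.

Lemma mem_span_prodsp s t W :
  {in s & t, forall x y, mulA x y \in W} -> (prodsp <<s>> <<t>> <= W)%VS.
Proof.
move=> h; apply/prodspP => x y.
move=> /(@coord_span _ _ _ (in_tuple s))-> /(@coord_span _ _ _ (in_tuple t))->.
rewrite linear_sumlz memv_suml // => i _.
rewrite linear_sumr memv_suml // => j _.
by rewrite linearZl_LR linearZr_LR !memvZ // h // mem_nth.
Qed.

Lemma std_decomposition_exists :
  evolution_algebra -> nondegenerate_algebra ->
  exists r (E : 'I_r -> {vspace A}), std_decomposition E.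
Proof.
move=> [e nbe] nd; have sq0 := natural_basis_sqr_neq0 nd nbe.
have [be orth] := nbe; have fe := basis_free be; have ue := free_uniq fe.
pose L x : {vspace A} := <[mulA x x]>%VS.
pose ls := undup [seq L x | x <- e].
pose M i := nth 0%VS ls i.
pose s (i : 'I_(size ls)) := [seq x <- e | L x == M i].
have sls x : x \in e -> L x \in ls by move=> ex; rewrite mem_undup map_f.
have s_e i : {subset s i <= e} by move=> x; rewrite mem_filter => /andP[].
have s_ne i : exists2 x, x \in s i & L x = M i.
  have : M i \in ls by rewrite /M mem_nth.
  rewrite {1}/ls mem_undup => /mapP[x ex lx]; exists x => //.
  by rewrite mem_filter ex -lx eqxx.
have dims i : \dim <<s i>> = size (s i).
  by apply/eqP; apply: filter_free.
exists (size ls), (fun i => <<s i>>%VS).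
have sumf : (\sum_i <<s i>> = fullv)%VS.
  apply/eqP; rewrite eqEsubv subvf -(span_basis be); apply/span_subvP => x ex.
  have lt : (index (L x) ls < size ls)%N by rewrite index_mem sls.
  have xs : x \in <<s (Ordinal lt)>>%VS.
    by rewrite memv_span // mem_filter ex /= /M nth_index ?sls ?eqxx.
  by apply: subvP xs; apply: (sumv_sup (Ordinal lt)).
have sqE i : prodsp <<s i>> <<s i>> = M i.
  have [x xs lx] := s_ne i; apply/eqP; rewrite eqEsubv; apply/andP; split.
    apply: mem_span_prodsp => y z ys zs.
    have [->|yz] := eqVneq y z; last by rewrite orth ?mem0v ?(s_e i).
    by move: zs; rewrite mem_filter => /andP[/eqP <- _]; apply: memv_line.
  by rewrite -lx -memvE mem_prodsp ?memv_span.
split.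
- split=> //; rewrite directvE /= sumf.
  rewrite (eq_bigr (fun i => size (s i))) => [|i _]; last exact: dims.
  rewrite -(span_basis be) (eqP fe).
  under eq_bigr => i _ do rewrite size_filter -sum1_count big_mkcond /=.
  rewrite exchange_big /= -sum1_size big_seq [X in _ == X]big_seq.
  apply/eqP/eq_bigr => x ex.
  have lt : (index (L x) ls < size ls)%N by rewrite index_mem sls.
  rewrite (bigD1 (Ordinal lt)) //= /M nth_index ?sls // eqxx big1 // => i ni.
  case: eqP => // lx; case/eqP: ni; apply: val_inj => /=.
  by rewrite lx index_uniq // undup_uniq.
- by move=> i; exists e, (s i).
- move=> i; rewrite sqE; have [x xs <-] := s_ne i.
  by rewrite dim_vline sq0 ?(s_e i).
move=> i j ij.
have lij : M i != M j by rewrite /M nth_uniq ?undup_uniq.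
split.
  apply/eqP; rewrite -subv0; apply: mem_span_prodsp => x y.
  rewrite !mem_filter => /andP[/eqP lx ex] /andP[/eqP ly ey].
  rewrite orth ?mem0v //; apply: contraNneq lij => xy.
  by rewrite -lx -ly xy.
rewrite !sqE; have [x xs lx] := s_ne i; have [y ys ly] := s_ne j.
have dx : \dim (M i) = 1%N by rewrite -lx dim_vline sq0 ?(s_e i).
have dy : \dim (M j) = 1%N by rewrite -ly dim_vline sq0 ?(s_e j).
apply/eqP; rewrite eqn_leq; apply/andP; split.
  by rewrite (leq_trans (dimv_add_leqif _ _)) ?dx ?dy.
rewrite ltnNge; apply: contra lij => d1.
have h1 : M i == (M i + M j)%VS by rewrite eqEdim addvSl dx.
have h2 : M j == (M i + M j)%VS by rewrite eqEdim addvSr dy.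
by rewrite (eqP h1) {2}(eqP h2).
Qed.
End EvolutionAlgebras.

Variant std_kind := Oalg | Ealg | Ialg.

Section DeltaTrace.
Variables (F : fieldType) (im : F).

(* The common square [v] of the basis vectors of O_m, E_m, I_m:
   0, e_1 and e_1 + im e_2 respectively (with [e_(j+1)] the [j]-th vector of
   the canonical basis of ['rV_m]). *)
Definition std_square (k : std_kind) (m : nat) : 'rV[F]_m :=
  \row_j match k, nat_of_ord j with
         | Ealg, 0 | Ialg, 0 => 1
         | Ialg, 1 => im
         | _, _ => 0
         end.

(* Bilinear extension of e_i e_j = 0 (i <> j), e_i^2 = v. *)
Definition std_mul (k : std_kind) (m : nat) (x y : 'rV[F]_m) : 'rV[F]_m :=
  (\sum_i x 0 i * y 0 i) *: std_square k m.

(* The pair [(m, Some k)] stands for the standard algebra of kind [k] and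
   dimension [m >= 1]; these are pairwise non-isomorphic (I_m being used only
   for [2 <= m]), so the order of the tests is immaterial.  The value [None]
   means that none of the three is isomorphic to the given algebra; this happens
   for some components over fields of characteristic 2, for instance for
   e_1^2 = e_2^2 = e_3^2 = e_1 + e_2 + e_3. *)
Definition kind_of (m : nat) (U : vectType F) (mulU : U -> U -> U) :
    option std_kind :=
  if `[< alg_iso mulU (@std_mul Oalg m) >] then Some Oalg
  else if `[< alg_iso mulU (@std_mul Ealg m) >] then Some Ealg
  else if (2 <= m)%N && `[< alg_iso mulU (@std_mul Ialg m) >] then Some Ialg
  else None.

Definition kind_rank (k : option std_kind) : nat :=
  match k with
  | Some Oalg => 0 | Some Ealg => 1 | Some Ialg => 2 | None => 3
  end.

Definition trace_le (a b : nat * option std_kind) : bool :=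
  (b.1 < a.1)%N || (a.1 == b.1) && (kind_rank a.2 <= kind_rank b.2)%N.

(* The trace read off a given standard decomposition. *)
Definition Delta_trace (A : vectType F) (mulA : {bilinear A -> A -> A})
    r (E : 'I_r -> {vspace A}) : seq (nat * option std_kind) :=
  sort trace_le
    [seq (\dim (E i), kind_of (\dim (E i)) (@component_mul F A mulA r E i))
    | i <- enum 'I_r].

End DeltaTrace.

(* Main.v *)
From HB Require Import structures.
Require Import Defs.
From mathcomp Require Import all_boot all_order all_algebra.
From mathcomp Require Import boolp.

Set Implicit Arguments.
Unset Strict Implicit.
Unset Printing Implicit Defensive.

Import GRing.Theory.
Local Open Scope ring_scope.

(* The decomposition is intrinsic: the lines L_i = E_i^2 are exactly the lines
   L for which {x | xA <= L} is nonzero, and E_i = {x | xA <= L_i}.  Indeed, if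
   x = \sum_j x_j with x_j in E_j and xA <= L, then x_j E_j <= L :&: L_j, which
   is 0 unless L = L_j, and x_j E_j = 0 forces x_j = 0 by non-degeneracy.  Hence
   an isomorphism permutes the summands, commutes with the projections onto
   them, and induces isomorphisms between the component algebras. *)

(** * Isomorphism of algebras and the kind of a component *)

Lemma lker0_linfun (F : fieldType) (U V : vectType F) (f : {linear U -> V}) :
  injective f -> lker (linfun f) == 0%VS.
Proof. by move=> injf; apply/lker0P => x y; rewrite !lfunE; apply: injf. Qed.

Lemma alg_iso_sym (F : fieldType) (U V : vectType F)
    (mulU : U -> U -> U) (mulV : V -> V -> V) :
  alg_iso mulU mulV -> alg_iso mulV mulU.
Proof.
case=> f [[g fK gK] fM].
have kf := lker0_linfun (can_inj fK).
(* [g] is only known as a function; [(linfun f)^-1] is linear and agrees with it. *)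
have gE : (linfun f)^-1%VF =1 g.
  by move=> y; rewrite -{1}(gK y) -[f _]lfunE lker0_lfunK.
exists (fun_of_lfun (linfun f)^-1%VF); split.
  by exists f => x /=; rewrite gE ?fK ?gK.
by move=> x y /=; rewrite !gE; apply: (can_inj fK); rewrite fM !gK.
Qed.

Lemma alg_iso_trans (F : fieldType) (U V W : vectType F) (mulU : U -> U -> U)
    (mulV : V -> V -> V) (mulW : W -> W -> W) :
  alg_iso mulU mulV -> alg_iso mulV mulW -> alg_iso mulU mulW.
Proof.
case=> f [bf fM] [g [bg gM]]; exists (g \o f); split; first exact: bij_comp.
by move=> x y /=; rewrite fM gM.
Qed.

Lemma kind_of_iso (F : fieldType) (im : F) m (U V : vectType F)
    (mulU : U -> U -> U) (mulV : V -> V -> V) :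
  alg_iso mulU mulV -> kind_of im m mulU = kind_of im m mulV.
Proof.
move=> UV; have isoE (W : vectType F) (mulW : W -> W -> W) :
    `[< alg_iso mulU mulW >] = `[< alg_iso mulV mulW >].
  by apply: asbool_equiv_eq; split; apply: alg_iso_trans => //; apply: alg_iso_sym.
by rewrite /kind_of !isoE.
Qed.

HB.instance Definition _ := gen_eqMixin std_kind.

Lemma trace_le_total : total trace_le.
Proof.
move=> [m k] [n l]; rewrite /trace_le /=.
by case: (ltngtP m n) => //= _; apply: leq_total.
Qed.

Lemma trace_le_trans : transitive trace_le.
Proof.
move=> [n l] [m k] [p q]; rewrite /trace_le /=.
case: (ltngtP n m) => //= [nm|->] h; case: (ltngtP p _) h => //=.
- by move=> pn _ _; rewrite (ltn_trans pn nm).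
- by move=> -> _ _; rewrite nm.
- by move=> _ kl; apply: leq_trans.
Qed.

(** [kind_rank] is injective on [option std_kind], so ties are equalities and a sorted trace depends
    only on the multiset of its entries. *)
Lemma trace_le_anti : antisymmetric trace_le.
Proof.
move=> [m k] [n l]; rewrite /trace_le /=.
case: (ltngtP m n) => //= -> /andP[kl lk]; congr pair.
have /eqP : kind_rank k == kind_rank l by rewrite eqn_leq kl lk.
by case: k l {kl lk} => [[]|] [[]|].
Qed.

(** * Intrinsic description of a standard decomposition *)

Section StandardDecomposition.
Variables (F : fieldType) (A : vectType F) (mulA : {bilinear A -> A -> A}).

(** On a natural basis both products vanish off the diagonal; bilinearity does the rest.
    Annihilation then needs checking on one side only. *)
Lemma evolution_algebra_comm :
  evolution_algebra mulA -> forall x y, mulA x y = mulA y x.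
Proof.
move=> [e [be orth]] x y.
have comm_e : {in e &, forall a b, mulA a b = mulA b a}.
  by move=> a b ea eb; have [->//|ab] := eqVneq a b; rewrite !orth // eq_sym.
have coordE z : z = \sum_i coord (in_tuple e) i z *: e`_i.
  by apply: (@coord_span _ _ _ (in_tuple e)); rewrite (span_basis be) memvf.
rewrite (coordE x) (coordE y) !linear_sumlz.
under eq_bigr do rewrite linear_sumr.
rewrite exchange_big; apply: eq_bigr => j _ /=.
rewrite linear_sumr; apply: eq_bigr => i _ /=.
by rewrite !(linearZl_LR, linearZr_LR) comm_e ?mem_nth // !scalerA mulrC.
Qed.

Variables (r : nat) (E : 'I_r -> {vspace A}).
Hypotheses (evA : evolution_algebra mulA) (ndA : nondegenerate_algebra mulA).
Hypothesis hE : std_decomposition mulA E.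

Local Notation L i := (prodsp mulA (E i) (E i)).

Lemma std_component_mul0 i j x y :
  i != j -> x \in E i -> y \in E j -> mulA x y = 0.
Proof.
case: hE => _ _ _ h /h[EE0 _] Ex Ey.
by apply/eqP; rewrite -memv0 -EE0 mem_prodsp.
Qed.

Lemma std_decompose x :
  exists2 u : 'I_r -> A, (forall i, u i \in E i) & x = \sum_i u i.
Proof.
have [[sumE _] _ _ _] := hE.
have /memv_sumP[u uE ->] : x \in (\sum_i E i)%VS by rewrite sumE memvf.
by exists u => // i; apply: uE.
Qed.

Lemma std_mul_component (u : 'I_r -> A) j y :
  (forall i, u i \in E i) -> y \in E j -> mulA (\sum_i u i) y = mulA (u j) y.
Proof.
move=> uE yE; rewrite linear_sumlz (bigD1 j) //= big1 ?addr0 // => i ij.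
exact: std_component_mul0 ij _ _.
Qed.

Lemma std_component_nondegenerate i x :
  x \in E i -> (forall y, y \in E i -> mulA x y = 0) -> x = 0.
Proof.
move=> Ex x0; apply: ndA => y; rewrite (evolution_algebra_comm evA y).
suff -> : mulA x y = 0 by [].
have [u uE ->] := std_decompose y; rewrite linear_sumr big1 // => j _.
by have [<-|ij] := eqVneq i j; [apply: x0 | apply: std_component_mul0 ij _ _].
Qed.

Lemma std_line_cap i j : i != j -> (L i :&: L j = 0)%VS.
Proof.
case: hE => _ _ dL h /h[_ dim2]; apply/eqP; rewrite -dimv_eq0.
(* The dimension formula reads [2 + \dim (L i :&: L j) = 1 + 1], whose right side is convertible to
   [2 + 0]. *)
by have := dimv_sum_cap (L i) (L j); rewrite dim2 !dL => /(@addnI 2 _ 0)/eqP.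
Qed.

Lemma mem_std_component i x : x \in E i <-> forall y, mulA x y \in L i.
Proof.
split=> [Ex y|xL].
  have [u uE ->] := std_decompose y.
  rewrite linear_sumr (bigD1 i) //= big1 ?addr0 ?mem_prodsp // => j ji.
  by apply: (std_component_mul0 _ Ex (uE j)); rewrite eq_sym.
have [u uE xE] := std_decompose x.
suff u0 j : j != i -> u j = 0 by rewrite xE (bigD1 i) //= big1 ?addr0.
(* For [y] in [E j], [mulA (u j) y] lies in [L j] and equals [mulA x y], which lies in [L i]. *)
move=> ji; apply: (std_component_nondegenerate (uE j)) => y Ey; apply/eqP.
rewrite -memv0 -(std_line_cap ji) memv_cap mem_prodsp //=.
by rewrite -(std_mul_component uE Ey) -xE.
Qed.

(** Some component [u i] of [x] is nonzero, hence has a nonzero product with some [y] in [E i]; that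
    product spans both [L i] and [M]. *)
Lemma std_line_of_vector x (M : {vspace A}) :
  x != 0 -> \dim M = 1%N -> (forall y, mulA x y \in M) -> exists i, M = L i.
Proof.
move=> x0 dM xM; have [u uE xE] := std_decompose x.
have [i ui0] : exists i, u i != 0.
  apply: contrapT => /forallNP u0; case/eqP: x0; rewrite xE big1 // => i _.
  by apply/eqP/negPn/negP/u0.
exists i; have [_ _ dL _] := hE.
have [y Ey uy0] : exists2 y, y \in E i & mulA (u i) y != 0.
  apply: contrapT => noy; case/eqP: ui0.
  apply: (std_component_nondegenerate (uE i)) => y Ey.
  by apply/eqP/negPn/negP => uy0; apply: noy; exists y.
have line (N : {vspace A}) :
    \dim N = 1%N -> mulA (u i) y \in N -> N = <[mulA (u i) y]>%VS.
  by move=> dN uN; apply/esym/eqP; rewrite eqEdim -memvE uN dN dim_vline uy0.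
rewrite (line (L i)) ?mem_prodsp //; apply: line => //.
by rewrite -(std_mul_component uE Ey) -xE.
Qed.

Lemma std_component_neq0 i : exists2 x, x \in E i & x != 0.
Proof.
exists (vpick (E i)); first exact: memv_pick.
rewrite vpick0; apply/negP => /eqP E0; have [_ _ dL _] := hE.
suff: \dim (L i) = 0%N by rewrite dL.
apply/eqP; rewrite dimv_eq0 -subv0; apply/prodspP => x y.
by rewrite E0 memv0 => /eqP-> _; rewrite linear0l memv0.
Qed.

Lemma std_component_inj : injective E.
Proof.
have [_ _ dL _] := hE; move=> i j ij; apply/eqP/negPn/negP => /std_line_cap.
by rewrite ij capvv => L0; have := dL j; rewrite L0 dimv0.
Qed.

End StandardDecomposition.

(** * Transport of the decomposition along an isomorphism *)

Section Isomorphism.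
Variables (F : fieldType) (A A' : vectType F).
Variables (mulA : {bilinear A -> A -> A}) (mulA' : {bilinear A' -> A' -> A'}).
Variables (r r' : nat) (E : 'I_r -> {vspace A}) (E' : 'I_r' -> {vspace A'}).
Hypotheses (evA : evolution_algebra mulA) (ndA : nondegenerate_algebra mulA).
Hypotheses (evA' : evolution_algebra mulA') (ndA' : nondegenerate_algebra mulA').
Hypotheses (hE : std_decomposition mulA E) (hE' : std_decomposition mulA' E').
Variable f : {linear A -> A'}.
Hypotheses (bij_f : bijective f) (fM : forall x y, f (mulA x y) = mulA' (f x) (f y)).

Lemma iso_std_component i :
  exists j, forall x, (f x \in E' j) = (x \in E i).
Proof.
have [_ _ dL _] := hE; have [g fK gK] := bij_f.
have kf := lker0_linfun (can_inj fK).
(* The image of the line of [E i]: it absorbs all products with [f x], for any nonzero [x] in [E i],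
   so it is the line of some [E' j]. *)
pose M := (linfun f @: prodsp mulA (E i) (E i))%VS.
have fMem x y : (mulA' (f x) y \in M) = (mulA x (g y) \in prodsp mulA (E i) (E i)).
  apply/memv_imgP/idP => [[z zL]|xyL].
    by rewrite lfunE -{1}(gK y) -fM => /(can_inj fK) ->.
  by exists (mulA x (g y)); rewrite // lfunE /= fM gK.
have [x Ex x0] := std_component_neq0 hE i.
have [||y|j Mj] := @std_line_of_vector _ _ _ _ _ evA' ndA' hE' (f x) M.
- by rewrite -(linear0 f) (inj_eq (can_inj fK)).
- by rewrite limg_dim_eq ?dL // (eqP kf) capv0.
- by rewrite fMem; apply: (mem_std_component evA ndA hE i x).1.
exists j => z; apply/idP/idP.
  move/(mem_std_component evA' ndA' hE'); rewrite -Mj => zM.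
  by apply/(mem_std_component evA ndA hE) => y; rewrite -(fK y) -fMem.
move/(mem_std_component evA ndA hE) => zL.
by apply/(mem_std_component evA' ndA' hE') => y; rewrite -Mj fMem.
Qed.

Lemma iso_std_component_index :
  exists2 s : 'I_r -> 'I_r', injective s
    & forall i x, (f x \in E' (s i)) = (x \in E i).
Proof.
have [s sP] := choice iso_std_component; exists s => // i j sij.
apply: (std_component_inj hE).
by apply/vspaceP => x; rewrite -!sP sij.
Qed.

Variable s : 'I_r -> 'I_r'.
Hypotheses (bij_s : bijective s)
  (sP : forall i x, (f x \in E' (s i)) = (x \in E i)).

(** Both families [u] and [v] below decompose [f x] along the [E' j], and such a decomposition is
    unique. *)
Lemma iso_sumv_pi i x :
  sumv_pi (\sum_j E' j)%VS (s i) (f x) = f (sumv_pi (\sum_j E j)%VS i x).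
Proof.
have [[sumE _] _ _ _] := hE; have [[sumE' dE'] _ _ _] := hE'.
have [t sK tK] := bij_s.
pose u j := sumv_pi (\sum_j E' j)%VS j (f x).
pose v j := f (sumv_pi (\sum_j E j)%VS (t j) x).
have uE j : true -> u j \in E' j by move=> _; apply: memv_sum_pi.
have vE j : true -> v j \in E' j.
  by move=> _; rewrite -{2}(tK j) sP; apply: memv_sum_pi.
have := directv_sum_unique dE' u v uE vE.
rewrite sumv_pi_sum ?sumE' ?memvf // (reindex_onto s t) => [|j _]; last exact: tK.
rewrite (eq_bigl xpredT) => [|j]; last by rewrite sK eqxx.
under [X in _ == X]eq_bigr do rewrite /v sK.
rewrite -linear_sum sumv_pi_sum ?sumE ?memvf // eqxx => /esym/forallP/(_ (s i)).
by rewrite /u /v sK => /eqP.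
Qed.

Lemma iso_component i :
  \dim (E i) = \dim (E' (s i)) /\
  alg_iso (@component_mul F A mulA r E i) (@component_mul F A' mulA' r' E' (s i)).
Proof.
have [g fK gK] := bij_f.
split.
  have <- : (linfun f @: E i)%VS = E' (s i).
    apply/vspaceP => y; apply/memv_imgP/idP => [[x Ex ->]|].
      by rewrite lfunE /= sP.
    by rewrite -(gK y) sP => Eg; exists (g y); rewrite ?lfunE.
  by rewrite limg_dim_eq // (eqP (lker0_linfun (can_inj fK))) capv0.
(* The restriction of [f]; [vsproj] changes no value, since [f] sends [E i] into [E' (s i)]. *)
exists (vsproj (E' (s i)) \o f \o vsval); split.
  exists (fun y => vsproj (E i) (g (vsval y))) => [x|y] /=.
    by rewrite vsprojK ?sP ?subvsP // fK vsvalK.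
  by rewrite vsprojK -?sP gK ?subvsP // vsvalK.
move=> x y; rewrite /component_mul /=.
rewrite !(vsprojK (U := E' (s i))) ?sP ?subvsP // vsprojK ?memv_sum_pi //.
by rewrite -fM iso_sumv_pi.
Qed.

End Isomorphism.

Theorem theorem22 (F : closedFieldType) (im : F) (him : im ^+ 2 = -1)
    (A A' : vectType F)
    (mulA : {bilinear A -> A -> A}) (mulA' : {bilinear A' -> A' -> A'})
    (evA : evolution_algebra mulA) (ndA : nondegenerate_algebra mulA)
    (evA' : evolution_algebra mulA') (ndA' : nondegenerate_algebra mulA')
    (isoAA' : alg_iso mulA mulA')
    (r r' : nat) (E : 'I_r -> {vspace A}) (E' : 'I_r' -> {vspace A'})
    (hE : std_decomposition mulA E) (hE' : std_decomposition mulA' E') :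
  Delta_trace im mulA E = Delta_trace im mulA' E'.
Proof.
have [f [bf fM]] := isoAA'; have [g [bg gM]] := alg_iso_sym isoAA'.
have [s inj_s sP] := iso_std_component_index evA ndA evA' ndA' hE hE' bf fM.
have [t inj_t _] := iso_std_component_index evA' ndA' evA ndA hE' hE bg gM.
(* The inverse isomorphism gives an injection [t] the other way, so counting makes [s] bijective. *)
have bs := inj_card_bij inj_s (leq_card t inj_t).
have [s' sK s'K] := bs.
(* Sorting under a total order reduces the claim to a permutation of the unsorted lists, here the
   one induced by [s]. *)
apply/(perm_sortP trace_le_total trace_le_trans trace_le_anti).
pose c' i := (\dim (E' i), kind_of im (\dim (E' i))
                            (@component_mul F A' mulA' r' E' i)).
rewrite (eq_map (g := c' \o s)) => [|i]; last first.
  have [dE iso] := iso_component hE hE' bf fM bs sP i.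
  by rewrite /c' /= dE (kind_of_iso _ _ iso).
rewrite map_comp; apply: perm_map; apply: uniq_perm.
- by rewrite map_inj_uniq ?enum_uniq.
- exact: enum_uniq.
- by move=> j; rewrite -(s'K j) mem_map // !mem_enum.
Qed.
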